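(* Let $A\in\mathbb{N}^{m\times n}$ and $b\in\mathbb{N}^m$. Then the following two statements (i) and (ii) are equivalent: (i) The linear system $Ax=b$ has a solution $x\in\mathbb{N}^n$. (ii) The real polynomial $z\mapsto z^b-1:=z_1^{b_1}\cdots z_m^{b_m}-1$ can be written $$z^b-1\,=\,\sum_{j=1}^n Q_j(z)\,(z^{A_j}-1)$$ for some polynomials $Q_j\in\mathbb{R}[z_1,\ldots,z_m]$, $j=1,\ldots,n$, all of them with nonnegative coefficients. In addition, when (i) and (ii) hold, the polynomials $Q_j$ in this representation can be taken of (total) degree bounded by $$b^*\,:=\,\sum_{j=1}^m b_j-\min_{k=1,\ldots,n}\,\sum_{j=1}^m A_{jk}.$$
   Context: $\mathbb{N}=\{0,1,2,\ldots\}$. For $A=(A_{ij})\in\mathbb{N}^{m\times n}$, $A_j\in\mathbb{N}^m$ denotes the $j$-th column of $A$, and $z^{A_j}:=z_1^{A_{1j}}\cdots z_m^{A_{mj}}$, a monomial of $\mathbb{R}[z_1,\ldots,z_m]$. The zero polynomial is regarded as satisfying every degree bound (degree $-\infty$). *)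

(* Defs.v *)
From HB Require Import structures.
From mathcomp Require Import all_boot all_order all_algebra.
From mathcomp Require Import reals.
From mathcomp Require Import mpoly.

Set Implicit Arguments.
Unset Strict Implicit.
Unset Printing Implicit Defensive.

Import Order.TTheory GRing.Theory Num.Theory.

Local Open Scope ring_scope.

Definition mono (R : realType) (m : nat) (v : 'cV[nat]_m) : {mpoly R[m]} :=
  'X_[R, [multinom v i ord0 | i < m]].

Definition nonneg_coeffs (R : realType) (m : nat) (p : {mpoly R[m]}) : Prop :=
  forall u : 'X_{1..m}, 0 <= p@_u.

(* [msize p] is the total degree plus one for [p != 0].  The bound [d] may be
   negative, and then only the zero polynomial satisfies it. *)
Definition deg_le (R : realType) (m : nat) (p : {mpoly R[m]}) (d : int) : Prop :=
  p = 0 \/ (msize p).-1%:Z <= d.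

Definition entry_sum (m : nat) (v : 'cV[nat]_m) : nat := (\sum_(i < m) v i ord0)%N.

(* The initial value of the iterated [minn] is the sum of all entries of [A],
   which is at least every column sum, so it does not affect the minimum when
   [n > 0] (see the two lemmas below). *)
Definition min_col_sum (m n : nat) (A : 'M[nat]_(m, n)) : nat :=
  \big[minn/(\sum_(k < n) entry_sum (col k A))%N]_(k < n) entry_sum (col k A).

Lemma min_col_sum_le (m n : nat) (A : 'M[nat]_(m, n)) (k : 'I_n) :
  (min_col_sum A <= entry_sum (col k A))%N.
Proof.
rewrite /min_col_sum; move: (\sum_(i < n) _)%N (mem_index_enum k) => S.
elim: (index_enum _) => // a s IHs; rewrite inE big_cons => /orP[/eqP<-|/IHs].
  exact: geq_minl.
by move=> le_s; exact: leq_trans (geq_minr _ _) le_s.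
Qed.

Lemma min_col_sum_attained (m n : nat) (A : 'M[nat]_(m, n)) :
  (0 < n)%N -> exists k : 'I_n, min_col_sum A = entry_sum (col k A).
Proof.
move=> n_gt0; pose k0 := Ordinal n_gt0.
have [|[k ->]] : min_col_sum A = (\sum_(k < n) entry_sum (col k A))%N \/
    exists k : 'I_n, min_col_sum A = entry_sum (col k A).
- rewrite /min_col_sum; elim/big_ind: _ => [|x y hx hy|k _]; first by left.
    by rewrite /minn; case: ifP.
  by right; exists k.
- move=> eqS; exists k0; apply/eqP; rewrite eqn_leq min_col_sum_le eqS.
  by rewrite (bigD1 k0) //= leq_addr.
- by exists k.
Qed.

Definition bstar (m n : nat) (A : 'M[nat]_(m, n)) (b : 'cV[nat]_m) : int :=
  (entry_sum b)%:Z - (min_col_sum A)%:Z.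

Definition nonneg_representation (R : realType) (m n : nat)
    (A : 'M[nat]_(m, n)) (b : 'cV[nat]_m) (Q : 'I_n -> {mpoly R[m]}) : Prop :=
  (forall j : 'I_n, nonneg_coeffs (Q j)) /\
  mono R b - 1 = \sum_(j < n) Q j * (mono R (col j A) - 1).

(* Main.v *)
Require Import Defs.
From HB Require Import structures.
From mathcomp Require Import all_boot all_order all_algebra.
From mathcomp Require Import reals boolp.
From mathcomp Require Import freeg mpoly.

Set Implicit Arguments.
Unset Strict Implicit.
Unset Printing Implicit Defensive.

Import Order.TTheory GRing.Theory Num.Theory.

Local Open Scope ring_scope.

(** Let S be the set of all A x with x a vector of natural numbers, that is,
    the submonoid generated by the columns of A.

    If b is in S, then b is reached from 0 by adding columns one at a time, and
    the identity z^(c + a) - 1 = (z^c - 1) + z^c (z^a - 1) adds one monomial z^c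
    to the multiplier of the column a at each step
    ([solvable_representation]).  The degree bound comes for free: c + a is a
    partial sum on the way to b, so |c| <= |b| - |a|, and |a| is at least the
    smallest column sum.

    Conversely, let L be the linear functional that sums the coefficients of a
    polynomial over the exponents in S.  As S is stable under adding a column
    a, L (z^u (z^a - 1)) = [u + a in S] - [u in S] is nonnegative for each u,
    hence so is L (Q (z^a - 1)) when Q has nonnegative coefficients
    ([weigh_shift_ge0]).  A representation of z^b - 1 thus gives
    0 <= L (z^b - 1) = [b in S] - [0 in S] = [b in S] - 1, and b is in S
    ([representation_solvable]).  Thus L plays the part of a Farkas certificate
    that would refute the representation if b were not in S. *)

(** * Monomials with a column vector as exponent *)

Lemma monoD (R : realType) (m : nat) (v w : 'cV[nat]_m) :
  mono R (v + w) = mono R v * mono R w.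
Proof.
rewrite /mono -mpolyXD; congr 'X_[_].
by apply/mnmP => i; rewrite mnmDE !mnmE mxE.
Qed.

Lemma mono0 (R : realType) (m : nat) : mono R (0 : 'cV[nat]_m) = 1.
Proof.
rewrite /mono -(mpolyX0 m R); congr 'X_[_].
by apply/mnmP => i; rewrite !mnmE mxE.
Qed.

Lemma msize_mono (R : realType) (m : nat) (v : 'cV[nat]_m) :
  msize (mono R v) = (entry_sum v).+1.
Proof.
rewrite msizeX mdegE; congr _.+1.
by apply: eq_bigr => i _; rewrite mnmE.
Qed.

Lemma entry_sumD (m : nat) (v w : 'cV[nat]_m) :
  entry_sum (v + w) = (entry_sum v + entry_sum w)%N.
Proof.
by rewrite /entry_sum -big_split; apply: eq_bigr => i _; rewrite mxE.
Qed.

(** * The monoid generated by the columns of a matrix *)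

Lemma mulmx_colE (m n : nat) (A : 'M[nat]_(m, n)) (x : 'cV[nat]_n) :
  A *m x = \sum_(k < n) col k A *+ x k ord0.
Proof.
apply/matrixP => i j; rewrite (ord1 j) mxE summxE; apply: eq_bigr => k _.
by rewrite mulmxnE mxE -mulr_natr natn.
Qed.

(** Induction on the number of generators in a sum: this is how membership of
    b in the monoid is turned into a step-by-step construction. *)
Lemma cone_ind (m n : nat) (A : 'M[nat]_(m, n)) (P : 'cV[nat]_m -> Prop) :
  P 0 -> (forall (k : 'I_n) c, P c -> P (c + col k A)) ->
  forall x : 'cV[nat]_n, P (A *m x).
Proof.
move=> P0 PD x; rewrite mulmx_colE.
elim: (index_enum _) => [|k s IHs]; first by rewrite big_nil.
rewrite big_cons addrC; elim: (x k ord0) => [|t IHt]; first by rewrite addr0.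
by rewrite mulrSr addrA; apply: PD.
Qed.

Lemma cone_closed (m n : nat) (A : 'M[nat]_(m, n)) (k : 'I_n) c :
  (exists x : 'cV[nat]_n, A *m x = c) ->
  exists x : 'cV[nat]_n, A *m x = c + col k A.
Proof.
by case=> x <-; exists (x + delta_mx k ord0); rewrite mulmxDr -colE.
Qed.

(** * From a representation to a solution *)

(** The linear functional on polynomials that sends each monomial 'X_[u] to
    [w u].  Lifting [w] from the basis of monomials to the free module
    underlying the polynomials makes additivity immediate, whereas a sum over
    the support would have to follow cancellations. *)
Definition weigh (R : realType) (m : nat) (w : 'X_{1..m} -> R)
  (p : {mpoly R[m]}) : R := fglift (w : _ -> R^o) (mpoly_val p).

Lemma weigh_is_zmod_morphism (R : realType) (m : nat) (w : 'X_{1..m} -> R) :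
  zmod_morphism (weigh w).
Proof. move=> p q; exact: (@lift_is_additive R _ R^o w). Qed.

HB.instance Definition _ (R : realType) (m : nat) (w : 'X_{1..m} -> R) :=
  GRing.isZmodMorphism.Build {mpoly R[m]} R (weigh w)
    (weigh_is_zmod_morphism w).

Lemma weighZX (R : realType) (m : nat) (w : 'X_{1..m} -> R) (c : R) u :
  weigh w (c *: 'X_[u]) = c * w u.
Proof.
have -> : c *: 'X_[u] = MPoly << c *g u >>.
  by apply/mpolyP => v; rewrite mcoeffZ mcoeffX mcoeff_MPoly coeffU.
by rewrite /weigh /= liftU.
Qed.

Lemma weighX (R : realType) (m : nat) (w : 'X_{1..m} -> R) u :
  weigh w 'X_[u] = w u.
Proof. by rewrite -[X in weigh _ X]scale1r weighZX mul1r. Qed.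

(** On a monomial 'X_[u] of [q] the value is [w (u + a) - w u], and the
    coefficients of [q] combine these increments with nonnegative weights. *)
Lemma weigh_shift_ge0 (R : realType) (m : nat) (w : 'X_{1..m} -> R)
    (a : 'X_{1..m}) (q : {mpoly R[m]}) :
  (forall u, w u <= w (u + a)%MM) -> nonneg_coeffs q ->
  0 <= weigh w (q * ('X_[a] - 1)).
Proof.
move=> w_incr q_ge0; rewrite [q]mpolyE mulr_suml raddf_sum.
apply: sumr_ge0 => u _.
rewrite mulrBr mulr1 -scalerAl -mpolyXD raddfB /= !weighZX -mulrBr.
by rewrite mulr_ge0 // subr_ge0.
Qed.

(** The weight is the indicator function of the monoid, which grows along
    every column because the monoid is stable under adding columns. *)
Lemma representation_solvable (R : realType) (m n : nat) (A : 'M[nat]_(m, n))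
    (b : 'cV[nat]_m) (Q : 'I_n -> {mpoly R[m]}) :
  nonneg_representation A b Q -> exists x : 'cV[nat]_n, A *m x = b.
Proof.
case=> Q_ge0 defQ.
pose vec (u : 'X_{1..m}) : 'cV[nat]_m := \col_i u i.
pose w u : R := `[< exists x : 'cV[nat]_n, A *m x = vec u >]%:R.
have vecE (v : 'cV[nat]_m) : vec [multinom v i ord0 | i < m] = v.
  by apply/matrixP => i j; rewrite (ord1 j) mxE mnmE.
have vec0 : vec 0%MM = 0 by apply/matrixP => i j; rewrite !mxE mnmE.
have vecD u v : vec (u + v)%MM = vec u + vec v.
  by apply/matrixP => i j; rewrite !mxE mnmDE.
have w_incr k u : w u <= w (u + [multinom col k A i ord0 | i < m])%MM.
  rewrite ler_nat /w vecD vecE.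
  by case: asboolP => // /(cone_closed k) /asboolP ->.
(* The same quantity is [b in S] - 1, as 0 lies in the monoid S. *)
have : 0 <= weigh w (mono R b - 1).
  rewrite defQ raddf_sum; apply: sumr_ge0 => k _.
  exact: weigh_shift_ge0.
rewrite raddfB /= -(mpolyX0 m R) !weighX /w vecE vec0.
have -> : `[< exists x : 'cV[nat]_n, A *m x = 0 >].
  by apply/asboolP; exists 0; rewrite mulmx0.
by case: asboolP => // _; rewrite sub0r oppr_ge0 ler10.
Qed.

(** * From a solution to a representation of bounded degree *)

Lemma representation0 (R : realType) (m n : nat) (A : 'M[nat]_(m, n)) :
  nonneg_representation A 0 (fun _ => 0 : {mpoly R[m]}).
Proof.
split=> [j u|]; first by rewrite mcoeff0.
by rewrite mono0 subrr big1 // => j _; rewrite mul0r.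
Qed.

(** Telescoping: z^(c + a) - 1 = (z^c - 1) + z^c (z^a - 1). *)
Lemma representationD (R : realType) (m n : nat) (A : 'M[nat]_(m, n))
    (c : 'cV[nat]_m) (k : 'I_n) (Q : 'I_n -> {mpoly R[m]}) :
  nonneg_representation A c Q ->
  nonneg_representation A (c + col k A)
    (fun j => Q j + (if j == k then mono R c else 0)).
Proof.
case=> Q_ge0 defQ; split=> [j u|].
  rewrite mcoeffD addr_ge0 //; first exact: Q_ge0.
  by case: ifP => _; rewrite ?mcoeff0 // mcoeffX ler0n.
under eq_bigr do rewrite mulrDl.
rewrite big_split /= -defQ (bigD1 k) //= eqxx big1 => [|j /negPf->].
  by rewrite addr0 monoD mulrBr mulr1 addrC addrA subrK.
by rewrite mul0r.
Qed.

Lemma deg_leD (R : realType) (m : nat) (p q : {mpoly R[m]}) (d : int) :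
  deg_le p d -> deg_le q d -> deg_le (p + q) d.
Proof.
case=> [->|le_p]; first by rewrite add0r.
case=> [->|le_q]; first by rewrite addr0; right.
right; apply: le_trans (_ : (maxn (msize p) (msize q)).-1%:Z <= _).
  by rewrite lez_nat -!subn1 leq_sub2r // msizeD_le.
by rewrite /maxn; case: ifP.
Qed.

(** The monomial added by a telescoping step meets the bound, since the entry
    sum of [c] is that of the new exponent minus one column sum. *)
Lemma deg_le_mono (R : realType) (m n : nat) (A : 'M[nat]_(m, n))
    (c : 'cV[nat]_m) (k : 'I_n) :
  deg_le (mono R c) (bstar A (c + col k A)).
Proof.
right; rewrite msize_mono /bstar entry_sumD PoszD -addrA lerDl subr_ge0.
exact: min_col_sum_le.
Qed.

(** The bound never decreases along the telescoping, so the multipliers already built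
    keep satisfying it. *)
Lemma deg_le_bstarD (R : realType) (m n : nat) (A : 'M[nat]_(m, n))
    (c v : 'cV[nat]_m) (p : {mpoly R[m]}) :
  deg_le p (bstar A c) -> deg_le p (bstar A (c + v)).
Proof.
case=> [|le_p]; [by left | right; apply: le_trans le_p _].
by rewrite lerD2r lez_nat entry_sumD leq_addr.
Qed.

Lemma solvable_representation (R : realType) (m n : nat)
    (A : 'M[nat]_(m, n)) (x : 'cV[nat]_n) :
  exists Q : 'I_n -> {mpoly R[m]},
    nonneg_representation A (A *m x) Q /\
    forall j : 'I_n, deg_le (Q j) (bstar A (A *m x)).
Proof.
pose P c := exists Q : 'I_n -> {mpoly R[m]},
  nonneg_representation A c Q /\ forall j : 'I_n, deg_le (Q j) (bstar A c).
apply: (@cone_ind _ _ A P) => [|k c [Q [reprQ degQ]]].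
  by exists (fun _ => 0); split; [exact: representation0 | left].
exists (fun j => Q j + (if j == k then mono R c else 0)).
split=> [|j]; first exact: representationD.
apply: deg_leD; first exact: deg_le_bstarD.
by case: ifP => _; [exact: deg_le_mono | left].
Qed.

Theorem theorem1 (R : realType) (m n : nat)
    (A : 'M[nat]_(m, n)) (b : 'cV[nat]_m) :
  ((exists x : 'cV[nat]_n, A *m x = b) <->
   (exists Q : 'I_n -> {mpoly R[m]}, nonneg_representation A b Q)) /\
  ((exists x : 'cV[nat]_n, A *m x = b) ->
   (exists Q : 'I_n -> {mpoly R[m]}, nonneg_representation A b Q) ->
   exists Q : 'I_n -> {mpoly R[m]},
     nonneg_representation A b Q /\
     (forall j : 'I_n, deg_le (Q j) (bstar A b))).
Proof.
split; last by case=> x <- _; exact: solvable_representation.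
split=> [[x <-]|[Q reprQ]]; last exact: representation_solvable reprQ.
by have [Q [reprQ _]] := solvable_representation R A x; exists Q.
Qed.
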